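(* Let $n\ge1$, $a>0$, and let $K_a$ be the Kasteleyn matrix of the Aztec diamond of size $n$ with weights $1$ and $a$, i.e. for $x\in\mathtt{B}$, $y\in\mathtt{W}$, $$K_a(x,y)=\begin{cases}1 & x-y=\pm e_1,\\ a\mathrm{i} & x-y=\pm e_2,\\ 0&\text{otherwise.}\end{cases}$$ Let $G_n(\mathtt{w},\mathtt{b})=\sum_{x\in\mathtt{W},\,y\in\mathtt{B}} K_a^{-1}(x,y)\,w_1^{x_1}w_2^{x_2}b_1^{y_1}b_2^{y_2}$. Then $$\begin{aligned}G_n(\mathtt{w},\mathtt{b})=&\ \frac{w_1w_2^2b_2\,f_{n+1}(w_1^2b_1^2)\,f_n(w_2^2b_2^2)}{C(w_1,w_2)}\\ &+(1+\mathrm{i}aw_1^2)\frac{(1+\mathrm{i}ab_2^2)F^{0,0}_n+b_1^2\big(b_2w_1f_n(b_1^2w_1^2)+(\mathrm{i}a+b_2^2)F^{0,1}_n\big)}{C(w_1,w_2)C(b_1,b_2)}\\ &+(\mathrm{i}a+w_1^2)w_2^2\frac{b_1^2b_2^{2n+1}w_1w_2^{2n}f_n(b_1^2w_1^2)+(1+\mathrm{i}ab_2^2)F^{1,0}_n+b_1^2(\mathrm{i}a+b_2^2)F^{1,1}_n}{C(w_1,w_2)C(b_1,b_2)},\end{aligned}$$ where $C(r_1,r_2)=1+r_1^2r_2^2+\mathrm{i}a(r_1^2+r_2^2)$ and $F^{k,l}_n=F^{k,l}_n(\mathtt{w},\mathtt{b},a)$ are as in the context.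
   Context: $\mathrm{i}=\sqrt{-1}$. Aztec diamond of size $n$: white vertices $\mathtt{W}=\{(x_1,x_2): x_1\text{ odd},\ x_2\text{ even},\ 1\le x_1\le 2n-1,\ 0\le x_2\le 2n\}$, black vertices $\mathtt{B}=\{(x_1,x_2): x_1\text{ even},\ x_2\text{ odd},\ 0\le x_1\le 2n,\ 1\le x_2\le 2n-1\}$, $e_1=(1,1)$, $e_2=(-1,1)$. $K_a$ has rows indexed by $\mathtt{B}$ and columns by $\mathtt{W}$; $K_a^{-1}$ is indexed by $\mathtt{W}\times\mathtt{B}$. $f_n(t)=(1-t^n)/(1-t)$. Define $F_n(w,b,a)=-\frac{\mathrm{i}\,a}{1+a^2}\,f_n\!\left(\frac{(1+ba\mathrm{i})(1+wa\mathrm{i})}{1+a^2}\right)$ and $F^{0,0}_n(\mathtt{w},\mathtt{b},a)=F_n(w_1^2,b_2^2,a)w_1b_2$, $F^{0,1}_n(\mathtt{w},\mathtt{b},a)=F_n(-1/w_1^2,-b_2^2,a^{-1})w_1^{2n-1}b_1^{2n}b_2\mathrm{i}/a$, $F^{1,0}_n(\mathtt{w},\mathtt{b},a)=F_n(-w_1^2,-1/b_2^2,a^{-1})w_1w_2^{2n}b_2^{2n-1}\mathrm{i}/a$, $F^{1,1}_n(\mathtt{w},\mathtt{b},a)=F_n(1/w_1^2,1/b_2^2,a)w_1^{2n-1}w_2^{2n}b_1^{2n}b_2^{2n-1}$. *)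

(* Defs.v *)
From HB Require Import structures.
From mathcomp Require Import all_boot all_order all_algebra.
Set Implicit Arguments. Unset Strict Implicit. Unset Printing Implicit Defensive.
Import Order.TTheory GRing.Theory Num.Theory.
Local Open Scope ring_scope.

(* Vertices of the Aztec diamond of size n are enumerated by 'I_(n.+1 * n):
   black vertex k  <->  (2*(k / n), 2*(k mod n)+1)        (x1 even in [0,2n], x2 odd in [1,2n-1])
   white vertex k  <->  (2*(k / (n+1))+1, 2*(k mod (n+1))) (x1 odd in [1,2n-1], x2 even in [0,2n])
   For n >= 1 these are bijections onto B and W respectively. *)
Definition bx1 (n k : nat) : nat := (2 * (k %/ n))%N.
Definition bx2 (n k : nat) : nat := (2 * (k %% n) + 1)%N.
Definition wx1 (n k : nat) : nat := (2 * (k %/ n.+1) + 1)%N.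
Definition wx2 (n k : nat) : nat := (2 * (k %% n.+1))%N.

Definition Kast (C : numClosedFieldType) (n : nat) (a : C) : 'M[C]_(n.+1 * n) :=
  \matrix_(i, j)
    let d1 : int := (bx1 n i)%:Z - (wx1 n j)%:Z in
    let d2 : int := (bx2 n i)%:Z - (wx2 n j)%:Z in
    if ((d1 == 1) && (d2 == 1)) || ((d1 == -1) && (d2 == -1)) then 1
    else if ((d1 == -1) && (d2 == 1)) || ((d1 == 1) && (d2 == -1)) then a * 'i
    else 0.

Definition Gn (C : numClosedFieldType) (n : nat) (a w1 w2 b1 b2 : C) : C :=
  \sum_(j < n.+1 * n) \sum_(i < n.+1 * n)
     invmx (Kast n a) j i * w1 ^+ (wx1 n j) * w2 ^+ (wx2 n j)
       * b1 ^+ (bx1 n i) * b2 ^+ (bx2 n i).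

(* f_n(t) = (1 - t^n)/(1 - t), read as the polynomial 1 + t + ... + t^(n-1). *)
Definition fpoly (C : numClosedFieldType) (n : nat) (t : C) : C := \sum_(k < n) t ^+ k.

Definition Fn (C : numClosedFieldType) (n : nat) (w b a : C) : C :=
  - ('i * a / (1 + a ^+ 2)) *
    fpoly n ((1 + b * a * 'i) * (1 + w * a * 'i) / (1 + a ^+ 2)).

Definition F00 (C : numClosedFieldType) (n : nat) (w1 w2 b1 b2 a : C) : C :=
  Fn n (w1 ^+ 2) (b2 ^+ 2) a * w1 * b2.
Definition F01 (C : numClosedFieldType) (n : nat) (w1 w2 b1 b2 a : C) : C :=
  Fn n (- (w1 ^+ 2)^-1) (- b2 ^+ 2) a^-1
    * w1 ^+ (2 * n - 1) * b1 ^+ (2 * n) * b2 * 'i / a.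
Definition F10 (C : numClosedFieldType) (n : nat) (w1 w2 b1 b2 a : C) : C :=
  Fn n (- w1 ^+ 2) (- (b2 ^+ 2)^-1) a^-1
    * w1 * w2 ^+ (2 * n) * b2 ^+ (2 * n - 1) * 'i / a.
Definition F11 (C : numClosedFieldType) (n : nat) (w1 w2 b1 b2 a : C) : C :=
  Fn n ((w1 ^+ 2)^-1) ((b2 ^+ 2)^-1) a
    * w1 ^+ (2 * n - 1) * w2 ^+ (2 * n) * b1 ^+ (2 * n) * b2 ^+ (2 * n - 1).

Definition Cden (C : numClosedFieldType) (a r1 r2 : C) : C :=
  1 + r1 ^+ 2 * r2 ^+ 2 + 'i * a * (r1 ^+ 2 + r2 ^+ 2).

(* Main.v *)
Require Import Defs.
From HB Require Import structures.
From mathcomp Require Import all_boot all_order all_algebra.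
From mathcomp Require Import ring zify.
Import Order.TTheory GRing.Theory Num.Theory.
Local Open Scope ring_scope.

(* Put u = w1^2, v = w2^2, J = i a, and let X_q(u), 0 <= q <= n, be the coefficient
   of v^q in G_n / w1, a polynomial of degree < n in u. Reading K_a K_a^-1 = 1 row
   by row gives, for s < n,
     (1 + J u) X_(s+1) + (u + J) X_s = b2 b2^(2s) f_(n+1)(b1^2 u).
   Summing this against v^(s+1) expresses C(w1,w2) G_n through the two sides X_0 and
   X_n only; iterating it gives
     (1 + J u)^n X_n - (-(u + J))^n X_0 = an explicit polynomial.
   Since 1 + J u and u + J are coprime (J^2 <> 1) and X_0, X_n have degree < n, this
   equation determines X_0 and X_n: its homogeneous version shows that K_a is
   invertible, and the sides are identified by checking that the claimed formulas
   satisfy it. *)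

(** * Homogeneous geometric sums *)

(** This is [(x^n - y^n) / (x - y)] as a polynomial, so [hgeom n 1 t] is [f_n(t)]. Having two
    arguments, it can absorb the negative powers of [w1] and [b2] in [F01], [F10] and [F11]. *)
Definition hgeom {R : comNzRingType} (n : nat) (x y : R) : R :=
  \sum_(k < n) x ^+ (n.-1 - k) * y ^+ k.

Lemma hgeomE {R : comNzRingType} n (x y : R) : (x - y) * hgeom n x y = x ^+ n - y ^+ n.
Proof. by rewrite subrXX. Qed.

Lemma hgeomS {R : comNzRingType} n (x y : R) :
  hgeom n.+1 x y = x * hgeom n x y + y ^+ n.
Proof.
rewrite /hgeom big_ord_recr /= subnn mul1r mulr_sumr; congr (_ + _).
apply: eq_bigr => k _; rewrite mulrA -exprS; congr (_ ^+ _ * _).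
by have := ltn_ord k; lia.
Qed.

Lemma rmorph_hgeom {R S : comNzRingType} (f : {rmorphism R -> S}) n x y :
  f (hgeom n x y) = hgeom n (f x) (f y).
Proof. by rewrite rmorph_sum; apply: eq_bigr => k _; rewrite rmorphM !rmorphXn. Qed.

Lemma size_hgeom {R : comNzRingType} n (x y : {poly R}) :
  (size x <= 2)%N -> (size y <= 2)%N -> (size (hgeom n x y) <= n)%N.
Proof.
have szX (z : {poly R}) k : (size z <= 2)%N -> (size (z ^+ k) <= k.+1)%N.
  move=> hz; apply: leq_trans (size_poly_exp_leq z k) _.
  by rewrite ltnS -[leqRHS]mul1n leq_mul2r; case: (size z) hz => [|[|[]]] //; rewrite orbT.
move=> hx hy; apply: leq_trans (size_sum _ _ _) _; apply/bigmax_leqP => k _.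
apply: leq_trans (size_polyMleq _ _) _.
move: (szX x (n.-1 - k)%N hx) (szX y k hy) (ltn_ord k).
by move: (size _) (size _) => s t; lia.
Qed.

(** * The closed forms of the two sides *)

(* Writing [J = i a], [c = 1 / (1 + a^2)], [t1 = b1^2], [t2 = b2^2], [u = w1^2],
   [b2 * bottom / Cden a b1 b2] and [b2 * top / Cden a b1 b2] are the
   coefficients of [w2^0] and [w2^(2n)] in [Gn / w1]. The four sums with a factor
   [c] are [F00], [F01], [F10] and [F11], homogenized so as to be polynomials in
   [u] and [t2]. *)
Definition bottom {R : comNzRingType} n (J c t1 t2 u : R) : R :=
  (1 + J * t2) * (- (J * c) * hgeom n 1 (c * (1 + J * t2) * (1 + J * u)))
  + t1 * hgeom n 1 (t1 * u)
  + t1 ^+ n.+1 * (J + t2)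
      * (c * hgeom n u (c * - (J + t2) * (1 + J * u))).

Definition top {R : comNzRingType} n (J c t1 t2 u : R) : R :=
  t1 * t2 ^+ n * hgeom n 1 (t1 * u)
  + (1 + J * t2) * (c * hgeom n t2 (c * (1 + J * t2) * - (u + J)))
  + t1 ^+ n.+1 * (J + t2)
      * (- (J * c) * hgeom n (u * t2) (c * - (J + t2) * - (u + J))).

Lemma rmorph_bottom {R S : comNzRingType} (f : {rmorphism R -> S}) n J c t1 t2 u :
  f (bottom n J c t1 t2 u) = bottom n (f J) (f c) (f t1) (f t2) (f u).
Proof.
by rewrite /bottom !(rmorphD, rmorphM, rmorphN, rmorphXn, rmorph_hgeom, rmorph1).
Qed.

Lemma rmorph_top {R S : comNzRingType} (f : {rmorphism R -> S}) n J c t1 t2 u :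
  f (top n J c t1 t2 u) = top n (f J) (f c) (f t1) (f t2) (f u).
Proof.
by rewrite /top !(rmorphD, rmorphM, rmorphN, rmorphXn, rmorph_hgeom, rmorph1).
Qed.

(** Multiplication by [L] turns each sum with factor [c] into a difference of n-th powers, because
    [c * J^2 = c - 1]. The powers containing [c] then cancel in pairs, [F10] against [F00] and [F11]
    against [F01]. *)
Lemma top_bottom {R : idomainType} n (J c t1 t2 u : R) :
  c * (1 - J ^+ 2) = 1 -> t2 + u + J + J * t2 * u != 0 ->
  (1 + J * u) ^+ n * top n J c t1 t2 u =
    (- (u + J)) ^+ n * bottom n J c t1 t2 u
    + (1 + t1 * t2 + J * (t1 + t2)) * hgeom n.+1 1 (t1 * u)
      * hgeom n (- (u + J)) (t2 * (1 + J * u)).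
Proof.
move=> hc; set L := (X in X != 0) => L0; apply: (mulfI L0).
have hc' : c * J ^+ 2 = c - 1 by rewrite -hc; ring.
have e1 x y : L * (- (J * c)) = x - y ->
    L * (- (J * c) * hgeom n x y) = x ^+ n - y ^+ n.
  by move=> e; rewrite -hgeomE -e; ring.
have e2 x y : L * c = x - y -> L * (c * hgeom n x y) = x ^+ n - y ^+ n.
  by move=> e; rewrite -hgeomE -e; ring.
have F00 := e1 1 (c * (1 + J * t2) * (1 + J * u)).
have F01 := e2 u (c * - (J + t2) * (1 + J * u)).
have F10 := e2 t2 (c * (1 + J * t2) * - (u + J)).
have F11 := e1 (u * t2) (c * - (J + t2) * - (u + J)).
have {}F00 := F00 ltac:(rewrite /L; ring: hc').
have {}F01 := F01 ltac:(rewrite /L; ring: hc').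
have {}F10 := F10 ltac:(rewrite /L; ring: hc').
have {}F11 := F11 ltac:(rewrite /L; ring: hc').
have FS : L * hgeom n (- (u + J)) (t2 * (1 + J * u)) =
    (t2 * (1 + J * u)) ^+ n - (- (u + J)) ^+ n.
  by rewrite -opprB -hgeomE /L; ring.
have Ff := hgeomE n 1 (t1 * u); rewrite !expr1n in F00 Ff.
have -> : L * ((1 + J * u) ^+ n * top n J c t1 t2 u) =
  (1 + J * u) ^+ n *
  (t1 * t2 ^+ n * hgeom n 1 (t1 * u) * L
   + (1 + J * t2) * (t2 ^+ n - (c * (1 + J * t2) * - (u + J)) ^+ n)
   + t1 ^+ n.+1 * (J + t2)
      * ((u * t2) ^+ n - (c * - (J + t2) * - (u + J)) ^+ n)).
  by rewrite -F10 -F11 /top; ring.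
have -> b e f : L * ((- (u + J)) ^+ n * b + e * f) =
  (- (u + J)) ^+ n * (L * b) + e * (L * f) by ring.
have -> : L * bottom n J c t1 t2 u =
   (1 + J * t2) * (1 - (c * (1 + J * t2) * (1 + J * u)) ^+ n)
   + t1 * hgeom n 1 (t1 * u) * L
   + t1 ^+ n.+1 * (J + t2)
      * (u ^+ n - (c * - (J + t2) * (1 + J * u)) ^+ n).
  by rewrite -F00 -F01 /bottom; ring.
rewrite FS hgeomS mul1r.
(* With [D] the first factor, this rests on [D = t1 * L + (1 + J * t2) * (1 - t1 * u)] and
   [D = (1 + J * t2) + t1 * (J + t2)]; [Ff] enters with coefficient [1 + J * t2]. *)
have -> : (1 + t1 * t2 + J * (t1 + t2)) * (hgeom n 1 (t1 * u) + (t1 * u) ^+ n) =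
  t1 * L * hgeom n 1 (t1 * u) + (1 + J * t2) + t1 * (J + t2) * (t1 * u) ^+ n.
  apply: subr0_eq; rewrite -[RHS](mulr0 (1 + J * t2)).
  by rewrite -(subrr (1 - (t1 * u) ^+ n)) -{1}Ff /L; ring.
rewrite !exprMn exprS.
move: (hgeom n 1 (t1 * u)) ((1 + J * t2) ^+ n) ((- (J + t2)) ^+ n) => f A B.
move: ((1 + J * u) ^+ n) ((- (u + J)) ^+ n) => p q.
move: L (t1 ^+ n) (t2 ^+ n) (u ^+ n) (c ^+ n) {hc hc' e1 e2 F00 F01 F10 F11 FS Ff L0}.
by move=> L T1 T2 U c'; ring.
Qed.

Lemma hgeom_scale {R : comNzRingType} n (z x y : R) :
  hgeom n (z * x) (z * y) = z ^+ n.-1 * hgeom n x y.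
Proof.
rewrite mulr_sumr; apply: eq_bigr => k _; rewrite !exprMn mulrACA -exprD.
by rewrite subnK //; case: n k => [|n] [k] //= lt_k_n; rewrite -ltnS.
Qed.

(** * First-order recurrences and uniqueness of the sides *)

Lemma linear_rec {R : comNzRingType} n (p q e t : R) (X : nat -> R) :
  (forall s, (s < n)%N -> p * X s.+1 = q * X s + e * t ^+ s) ->
  p ^+ n * X n = q ^+ n * X 0%N + e * hgeom n q (t * p).
Proof.
elim: n => [_|n IHn hX]; first by rewrite /hgeom big_ord0 mulr0 addr0.
rewrite exprSr -mulrA hX // mulrDr mulrCA IHn => [|s /ltnW/hX //].
by rewrite hgeomS exprMn [q ^+ n.+1]exprS; ring.
Qed.

(** The factor on the left is [(1 + J * u) + v * (u + J)]; weighting the recurrence by [v^(s+1)] and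
    summing leaves only the two end terms. *)
Lemma linear_rec_gen {R : comNzRingType} n (J u v e t : R) (X : nat -> R) :
  (forall s, (s < n)%N -> (1 + J * u) * X s.+1 = - (u + J) * X s + e * t ^+ s) ->
  (1 + u * v + J * (u + v)) * (\sum_(q < n.+1) X q * v ^+ q) =
    e * v * hgeom n 1 (v * t) + (u + J) * v ^+ n.+1 * X n + (1 + J * u) * X 0%N.
Proof.
elim: n => [_|n IHn hX].
  by rewrite big_ord1 /hgeom big_ord0; ring.
rewrite big_ord_recr /= mulrDr IHn => [|s /ltnW/hX //].
(* The two sides differ by [v ^+ n.+1] times the last instance of the recurrence. *)
apply: subr0_eq; rewrite -[RHS](mulr0 (v ^+ n.+1)).
by rewrite -(subrr ((1 + J * u) * X n.+1)) {2}hX // hgeomS exprMn !exprS; ring.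
Qed.

(** At the root [-J] of [X + J], the other factor equals [1 - J^2], so the powers are coprime. Hence
    [(X + J)^n] divides [A], which has degree below [n]. *)
Lemma coprime_powers {F : fieldType} n (J : F) (A B : {poly F}) :
  J ^+ 2 != 1 -> (size A <= n)%N -> (size B <= n)%N ->
  (1 + J%:P * 'X) ^+ n * A = (- ('X + J%:P)) ^+ n * B -> A = 0 /\ B = 0.
Proof.
move=> hJ sA sB eAB.
have cop : coprimep (('X + J%:P) ^+ n) ((1 + J%:P * 'X) ^+ n).
  apply/coprimep_expl/coprimep_expr; rewrite coprimep_sym.
  have -> : 'X + J%:P = 'X - (- J)%:P by rewrite polyCN opprK.
  by rewrite coprimep_XsubC /root !hornerE mulrN -expr2 subr_eq0 eq_sym.
have sX : size (('X + J%:P) ^+ n) = n.+1 by rewrite -[J%:P]opprK -polyCN size_exp_XsubC.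
have A0 : A = 0.
  apply/eqP; apply: contraTT sA => A0; rewrite -ltnNge -sX dvdp_leq //.
  by rewrite -(Gauss_dvdpr _ cop) eAB exprNn mulrAC dvdp_mull.
split=> //; move/eqP: eAB; rewrite A0 mulr0 eq_sym mulf_eq0 expf_eq0 oppr_eq0.
by rewrite -size_poly_eq0 -[J%:P]opprK -polyCN size_XsubC andbF => /eqP.
Qed.

(** * Rows of the Kasteleyn matrix as polynomial identities *)

Lemma sum_divmod {V : nmodType} m n (F : nat -> V) :
  \sum_(k < n * m) F k = \sum_(p < n) \sum_(q < m) F (p * m + q)%N.
Proof.
rewrite -(big_mkord xpredT) big_nat_mul big_mkord; apply: eq_bigr => p _.
rewrite -{1}[(p * m)%N]add0n big_addn mulSn addnK big_mkord.
by apply: eq_bigr => q _; rewrite addnC.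
Qed.

(* The coefficient of [w2^(2q)] in [1 / w1] times the generating function of a
   function [x] on the white vertices, as a polynomial in [w1^2]. *)
Definition colp {R : comNzRingType} n (x : nat -> R) q : {poly R} :=
  \poly_(p < n) x (p * n.+1 + q)%N.

(** A coefficient of [\poly_(p < n)] is zero out of range, which accounts for the missing neighbours
    of boundary vertices. *)
Lemma sum_delta {R : comNzRingType} n m (x : nat -> R) p0 q0 :
  (q0 < m)%N ->
  \sum_(p < n) \sum_(q < m)
     ((p == p0 :> nat) && (q == q0 :> nat))%:R * x (p * m + q)%N =
  (\poly_(p < n) x (p * m + q0)%N)`_p0.
Proof.
move=> hq; have inner (p : 'I_n) :
    \sum_(q < m) ((p == p0 :> nat) && (q == q0 :> nat))%:R * x (p * m + q)%N =
    (p == p0 :> nat)%:R * x (p * m + q0)%N.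
  rewrite (bigD1 (Ordinal hq)) //= eqxx andbT big1 ?addr0 // => q neq.
  have /negPf-> : (q != q0 :> nat) by apply: contra neq => /eqP e; apply/eqP/val_inj.
  by rewrite andbF mul0r.
rewrite (eq_bigr _ (fun p _ => inner p)) coef_poly.
case: ltnP => [lt_p0|le_n]; last first.
  by rewrite big1 // => p _; rewrite ltn_eqF ?mul0r // (leq_trans (ltn_ord p)).
rewrite (bigD1 (Ordinal lt_p0)) //= eqxx mul1r big1 ?addr0 // => p neq.
have /negPf-> : (p != p0 :> nat) by apply: contra neq => /eqP e; apply/eqP/val_inj.
by rewrite mul0r.
Qed.

(** In halved coordinates, black [(2r, 2s+1)] is adjacent to white [(2p+1, 2q)] for [p] in
    [{r-1, r}] and [q] in [{s, s+1}]. Writing [p.+1 == r] rather than [p == r.-1] gives no left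
    neighbour when [r = 0]. *)
Lemma KastE {C : numClosedFieldType} n (a : C) (i j : 'I_(n.+1 * n)) r s p q :
  (i = r * n + s :> nat)%N -> (j = p * n.+1 + q :> nat)%N ->
  (s < n)%N -> (q < n.+1)%N ->
  Kast n a i j =
    ((p.+1 == r) && (q == s))%:R + ((p == r) && (q == s.+1))%:R
    + 'i * a * (((p == r) && (q == s))%:R + ((p.+1 == r) && (q == s.+1))%:R).
Proof.
move=> ei ej hs hq; rewrite mxE /bx1 /bx2 /wx1 /wx2 ei ej.
have n0 : (0 < n)%N by apply: leq_ltn_trans hs.
rewrite !divnMDl // !modnMDl !divn_small // !modn_small // !addn0.
have -> : ((2 * r)%N%:Z - (2 * p + 1)%N%:Z == 1) = (p.+1 == r) by lia.
have -> : ((2 * r)%N%:Z - (2 * p + 1)%N%:Z == -1) = (p == r) by lia.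
have -> : ((2 * s + 1)%N%:Z - (2 * q)%N%:Z == 1) = (q == s) by lia.
have -> : ((2 * s + 1)%N%:Z - (2 * q)%N%:Z == -1) = (q == s.+1) by lia.
have : ~~ ((p.+1 == r) && (p == r)) by lia.
have : ~~ ((q == s) && (q == s.+1)) by lia.
by case: (p.+1 == r) (p == r) (q == s) (q == s.+1) => [] [] [] [] //= _ _; ring.
Qed.

(** A neighbour with [p.+1 = r] contributes a coefficient of index [r - 1], hence a factor ['X]. *)
Lemma Kast_row {C : numClosedFieldType} n (a : C) (x : nat -> C)
    (i : 'I_(n.+1 * n)) r s :
  (i = r * n + s :> nat)%N -> (s < n)%N ->
  \sum_j Kast n a i j * x j =
  ((1 + ('i * a)%:P * 'X) * colp n x s.+1 + ('X + ('i * a)%:P) * colp n x s)`_r.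
Proof.
move=> ei hs; set J := 'i * a.
pose K p q : C := ((p.+1 == r) && (q == s))%:R + ((p == r) && (q == s.+1))%:R
    + J * (((p == r) && (q == s))%:R + ((p.+1 == r) && (q == s.+1))%:R).
transitivity (\sum_(k < n.+1 * n) K (k %/ n.+1)%N (k %% n.+1)%N * x k).
  apply: eq_bigr => j _; congr (_ * _).
  by apply: KastE ei _ hs _; rewrite ?ltn_mod // -divn_eq.
rewrite [(n.+1 * n)%N]mulnC (sum_divmod _ _ (fun k => K (k %/ _)%N (k %% _)%N * x k)).
transitivity (\sum_(p < n) \sum_(q < n.+1) K p q * x (p * n.+1 + q)%N).
  apply: eq_bigr => p _; apply: eq_bigr => q _.
  by rewrite divnMDl // modnMDl divn_small // modn_small // addn0.
have shift q0 : (q0 < n.+1)%N ->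
    \sum_(p < n) \sum_(q < n.+1)
       ((p.+1 == r) && (q == q0 :> nat))%:R * x (p * n.+1 + q)%N = ('X * colp n x q0)`_r.
  move=> hq0; rewrite coefXM; case: r {ei K} => [|r] /=.
    by rewrite big1 // => p _; rewrite big1 // => q _; rewrite mul0r.
  by rewrite -sum_delta.
have hs1 : (s < n.+1)%N by apply: ltnW.
rewrite !mulrDl mul1r -mulrA !coefD !coefCM -!shift // /colp -!sum_delta //.
rewrite !mulr_sumr -!big_split; apply: eq_bigr => p _.
rewrite !mulr_sumr -!big_split; apply: eq_bigr => q _.
by rewrite /K /=; ring.
Qed.

Lemma Kast_rec {C : numClosedFieldType} n (a : C) (x y : nat -> C) s :
  (forall i : 'I_(n.+1 * n), \sum_j Kast n a i j * x j = y i) -> (s < n)%N ->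
  (1 + ('i * a)%:P * 'X) * colp n x s.+1 =
  - ('X + ('i * a)%:P) * colp n x s + \poly_(r < n.+1) y (r * n + s)%N.
Proof.
move=> hxy hs; rewrite mulNr [RHS]addrC; apply/esym/eqP.
rewrite subr_eq eq_sym; apply/eqP.
apply/polyP => r; rewrite [RHS]coef_poly; case: ltnP => hr.
  have hi : (r * n + s < n.+1 * n)%N.
    by apply: leq_trans (leq_mul hr (leqnn n)); rewrite mulSn addnC ltn_add2r.
  by rewrite -(Kast_row _ _ _ (Ordinal hi) r s erefl hs) hxy.
(* Here [r > n], so even the shifted index [r - 1] is at least [n] and every coefficient
   vanishes. *)
have z q : (colp n x q)`_r = 0 by rewrite coef_poly ltnNge (ltnW hr).
have z' q : (colp n x q)`_r.-1 = 0
  by rewrite coef_poly ltnNge; case: r hr {z} => // r hr; rewrite (hr : (n <= r)%N).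
by rewrite !mulrDl mul1r -mulrA !coefD !coefCM !coefXM !z !z' !if_same !mulr0 !addr0.
Qed.

(** * Invertibility of the Kasteleyn matrix *)

Lemma onep_sqr_neq0 {C : numClosedFieldType} (a : C) : 0 < a -> 1 + a ^+ 2 != 0.
Proof. by move=> a_gt0; rewrite gt_eqF // addr_gt0 // exprn_gt0. Qed.

Lemma sqr_ia {C : numClosedFieldType} (a : C) : ('i * a) ^+ 2 = - a ^+ 2.
Proof. by rewrite exprMn sqrCi mulN1r. Qed.

Lemma sqr_ia_neq1 {C : numClosedFieldType} (a : C) : 0 < a -> ('i * a) ^+ 2 != 1.
Proof.
move=> /onep_sqr_neq0; apply: contra => /eqP; rewrite sqr_ia => <-.
by rewrite addNr.
Qed.

(** Extension by zero, so that indices [p * n.+1 + q] need no bound proofs. *)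
Definition ext {R : comNzRingType} {N} (v : 'rV[R]_N) (k : nat) : R :=
  oapp (v 0) 0 (insub k).

Lemma ext_val {R : comNzRingType} {N} (v : 'rV[R]_N) (j : 'I_N) : ext v j = v 0 j.
Proof. by rewrite /ext valK. Qed.

Lemma Kast_unit {C : numClosedFieldType} n (a : C) : 0 < a -> Kast n a \in unitmx.
Proof.
move=> a_gt0; rewrite -unitmx_tr -row_free_unit; apply: inj_row_free => v hv.
have hx (i : 'I_(n.+1 * n)) : \sum_j Kast n a i j * ext v j = (fun=> 0) (i : nat).
  transitivity ((v *m (Kast n a)^T) 0 i); last by rewrite hv mxE.
  by rewrite [RHS]mxE; apply: eq_bigr => j _; rewrite [_^T _ _]mxE ext_val mulrC.
(* The zero source is written [0 * 0 ^+ s] to fit [linear_rec]. *)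
have rec s : (s < n)%N -> (1 + ('i * a)%:P * 'X) * colp n (ext v) s.+1 =
    - ('X + ('i * a)%:P) * colp n (ext v) s + 0 * 0 ^+ s.
  move=> hs; apply: etrans (Kast_rec n a (ext v) (fun=> 0) s hx hs) _.
  rewrite mul0r; congr (_ + _).
  by apply/polyP => r; rewrite coef_poly coef0 /= if_same.
have := linear_rec _ _ _ _ _ _ rec; rewrite mul0r addr0 => e.
have [_ col0] := coprime_powers _ _ _ _ (sqr_ia_neq1 _ a_gt0)
  (size_poly _ _) (size_poly _ _) e.
(* From [X_0 = 0] the recurrence propagates zero, since [1 + J X] has constant coefficient 1 and is
   not the zero polynomial. *)
have col_eq0 s : (s <= n)%N -> colp n (ext v) s = 0.
  elim: s => [//|s IHs] hs; have := rec s hs.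
  rewrite IHs ?(ltnW hs) // mulr0 mul0r addr0 => /eqP; rewrite mulf_eq0.
  case/orP => [/eqP /(congr1 (fun p : {poly C} => p`_0))|/eqP //].
  by rewrite coefD coef1 coefMX coef0 addr0 => /eqP; rewrite oner_eq0.
apply/rowP => j; rewrite mxE -ext_val (divn_eq j n.+1).
have := col_eq0 (j %% n.+1)%N; rewrite -ltnS ltn_mod => /(_ isT).
move/(congr1 (fun p : {poly C} => p`_(j %/ n.+1))); rewrite coef0 coef_poly.
by rewrite ltn_divLR // [(n * n.+1)%N]mulnC ltn_ord.
Qed.

(** * Degree bounds and identification of the sides *)

Lemma size_mulC_leq {R : nzRingType} (k : R) (p : {poly R}) m :
  (size p <= m)%N -> (size (k%:P * p)%R <= m)%N.
Proof. by rewrite mul_polyC; apply: leq_trans (size_scale_leq _ _). Qed.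

Lemma size_add_leq {R : nzRingType} (p q : {poly R}) m :
  (size p <= m)%N -> (size q <= m)%N -> (size (p + q)%R <= m)%N.
Proof. by move=> hp hq; rewrite (leq_trans (size_polyD _ _)) // geq_max hp. Qed.

Lemma size_subC_leq {R : nzRingType} (k l : R) (p q : {poly R}) m :
  (size p <= m)%N -> (size q <= m)%N -> (size (k%:P * p - l%:P * q)%R <= m)%N.
Proof. by move=> hp hq; rewrite size_add_leq ?size_polyN ?size_mulC_leq. Qed.

Lemma size_const_leq2 {R : nzRingType} (k : R) : (size k%:P <= 2)%N.
Proof. exact: leq_trans (size_polyC_leq1 k) _. Qed.

Lemma size_top {R : comNzRingType} n (J c t1 t2 : R) :
  (size (top n J%:P c%:P t1%:P t2%:P 'X) <= n)%N.
Proof.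
rewrite /top -polyC1 -!(polyC_exp, polyCM, polyCD, polyCN) ['X * _]mulrC.
by do ![apply: size_add_leq | apply: size_mulC_leq | apply: size_hgeom
  | rewrite size_polyN]; rewrite ?size_const_leq2 ?size_polyX.
Qed.

Lemma size_bottom {R : comNzRingType} n (J c t1 t2 : R) :
  (size (bottom n J%:P c%:P t1%:P t2%:P 'X) <= n)%N.
Proof.
rewrite /bottom -polyC1 -!(polyC_exp, polyCM, polyCD, polyCN).
by do ![apply: size_add_leq | apply: size_mulC_leq | apply: size_hgeom];
  rewrite ?size_const_leq2 ?size_polyX.
Qed.

(** By [top_bottom], [D X_n - b top] and [D X_0 - b bottom] satisfy the homogeneous equation in
    degree below [n], so both vanish by [coprime_powers]. *)
Lemma Kast_sides {C : numClosedFieldType} n (a b t1 t2 : C) (x : nat -> C) :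
  0 < a ->
  (forall i : 'I_(n.+1 * n),
     \sum_j Kast n a i j * x j = b * t1 ^+ (i %/ n) * t2 ^+ (i %% n)) ->
  let J := 'i * a in let c := (1 + a ^+ 2)^-1 in
  let D := 1 + t1 * t2 + J * (t1 + t2) in
  [/\ forall s u, (s < n)%N -> (1 + J * u) * (colp n x s.+1).[u] =
        - (u + J) * (colp n x s).[u] + b * hgeom n.+1 1 (t1 * u) * t2 ^+ s,
      forall u, D * (colp n x n).[u] = b * top n J c t1 t2 u
    & forall u, D * (colp n x 0).[u] = b * bottom n J c t1 t2 u].
Proof.
move=> a_gt0 hx J c D.
have rec s : (s < n)%N -> (1 + J%:P * 'X) * colp n x s.+1 =
    - ('X + J%:P) * colp n x s + b%:P * hgeom n.+1 1 (t1%:P * 'X) * t2%:P ^+ s.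
  move=> hs; have n0 : (0 < n)%N by apply: leq_ltn_trans hs.
  pose y k := b * t1 ^+ (k %/ n) * t2 ^+ (k %% n).
  apply: etrans (Kast_rec n a x y s hx hs) _.
  congr (_ + _).
  rewrite /hgeom mulr_sumr mulr_suml poly_def; apply: eq_bigr => r _.
  rewrite /y divnMDl // modnMDl divn_small // modn_small // addn0 expr1n mul1r.
  by rewrite exprMn -mul_polyC !polyCM !polyC_exp; ring.
have hD : 1 + t1%:P * t2%:P + J%:P * (t1%:P + t2%:P) = D%:P.
  by rewrite /D !(polyCD, polyCM).
have cJ : c%:P * (1 - J%:P ^+ 2) = 1 :> {poly C}.
  rewrite -polyC_exp sqr_ia polyCN opprK -polyCD -polyCM mulVf //.
  exact: onep_sqr_neq0.
(* Vanishing would force [t2 = -J] and [1 + J * t2 = 0], that is [J^2 = 1]. *)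
have L0 : t2%:P + 'X + J%:P + J%:P * t2%:P * 'X != 0 :> {poly C}.
  apply/eqP => e; have := congr1 (fun p : {poly C} => (p`_0, p`_1)) e.
  rewrite -polyCM !coefD !coefCM !coefC !coefX /= !(addr0, add0r, mulr0, mulr1).
  case=> e0 e1; have := sqr_ia_neq1 _ a_gt0; rewrite -/J => /eqP; apply.
  by move: e0 e1 => /eqP; rewrite addr_eq0 => /eqP->; rewrite mulrN -expr2 => /subr0_eq.
have e := linear_rec _ _ _ _ _ _ rec.
have {}e : (1 + J%:P * 'X) ^+ n
      * (D%:P * colp n x n - b%:P * top n J%:P c%:P t1%:P t2%:P 'X) =
    (- ('X + J%:P)) ^+ n
      * (D%:P * colp n x 0 - b%:P * bottom n J%:P c%:P t1%:P t2%:P 'X).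
  rewrite mulrBr mulrCA e [_ ^+ n * (b%:P * _)]mulrCA top_bottom // hD.
  by ring.
have [||top_eq bottom_eq] := coprime_powers _ _ _ _ (sqr_ia_neq1 _ a_gt0) _ _ e.
- by rewrite size_subC_leq ?size_poly ?size_top.
- by rewrite size_subC_leq ?size_poly ?size_bottom.
clearbody J.
(* Evaluation at [u] is a ring morphism, so it carries [top] and [bottom] to their values. *)
pose ev u : {rmorphism {poly C} -> C} := horner_eval u.
have evC (u k : C) : ev u k%:P = k by apply: hornerC.
have evX u : ev u 'X = u by apply: hornerX.
split=> [s u hs|u|u].
- have := congr1 (ev u) (rec s hs).
  rewrite !(rmorphD, rmorphM, rmorphN, rmorphXn, rmorph_hgeom, rmorph1).
  by rewrite !evC evX.
- have := congr1 (ev u) top_eq.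
  rewrite rmorph0 rmorphB !rmorphM rmorph_top !evC evX; exact: subr0_eq.
- have := congr1 (ev u) bottom_eq.
  rewrite rmorph0 rmorphB !rmorphM rmorph_bottom !evC evX; exact: subr0_eq.
Qed.

(** * Homogenized forms of the four functions [F] *)

Lemma fpolyE {C : numClosedFieldType} n (t : C) : fpoly n t = hgeom n 1 t.
Proof. by apply: eq_bigr => k _; rewrite expr1n mul1r. Qed.

Lemma F00E {C : numClosedFieldType} n (w1 w2 b1 b2 a : C) :
  F00 n w1 w2 b1 b2 a =
  w1 * b2 * (- ('i * a * (1 + a ^+ 2)^-1)
    * hgeom n 1 ((1 + a ^+ 2)^-1 * (1 + 'i * a * b2 ^+ 2) * (1 + 'i * a * w1 ^+ 2))).
Proof.
rewrite /F00 /Fn fpolyE.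
have -> : (1 + b2 ^+ 2 * a * 'i) * (1 + w1 ^+ 2 * a * 'i) / (1 + a ^+ 2) =
  (1 + a ^+ 2)^-1 * (1 + 'i * a * b2 ^+ 2) * (1 + 'i * a * w1 ^+ 2) by ring.
by ring.
Qed.

Lemma onep_sqrV {F : fieldType} (a : F) :
  a != 0 -> 1 + a^-1 ^+ 2 = (1 + a ^+ 2) / a ^+ 2.
Proof. by move=> a_neq0; field. Qed.

Lemma exprM2B1 {R : comNzRingType} n (x : R) :
  (0 < n)%N -> x ^+ (2 * n - 1) = x * (x ^+ 2) ^+ n.-1.
Proof. by case: n => [//|n] _; rewrite -exprM -exprS mulnS. Qed.

(** [w1^(2n-1)] is [w1] times the factor [(w1^2)^(n-1)] that [hgeom_scale] absorbs, which clears
    [w1^-2]. The same works for [F10] with [b2], and for [F11] with both. *)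
Lemma F01E {C : numClosedFieldType} n (w1 w2 b1 b2 a : C) :
  (0 < n)%N -> 0 < a -> w1 != 0 ->
  F01 n w1 w2 b1 b2 a =
  w1 * b2 * (b1 ^+ 2) ^+ n * ((1 + a ^+ 2)^-1
    * hgeom n (w1 ^+ 2) ((1 + a ^+ 2)^-1 * - ('i * a + b2 ^+ 2) * (1 + 'i * a * w1 ^+ 2))).
Proof.
move=> n0 a0 hw; have a2 := onep_sqr_neq0 a a0; have an0 : a != 0 by rewrite gt_eqF.
have ci : 'i ^+ 2 = -1 :> C := sqrCi C.
rewrite /F01 /Fn fpolyE onep_sqrV //.
set z := (X in hgeom n 1 X); set y := (X in _ = _ * (_ * hgeom n _ X)).
have -> : y = w1 ^+ 2 * z by rewrite /y /z; field: ci; rewrite ?an0 ?hw ?a2.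
rewrite -[X in hgeom n X (_ * z)]mulr1 hgeom_scale exprM2B1 // exprM.
by field: ci; rewrite ?an0 ?a2.
Qed.

Lemma F10E {C : numClosedFieldType} n (w1 w2 b1 b2 a : C) :
  (0 < n)%N -> 0 < a -> b2 != 0 ->
  F10 n w1 w2 b1 b2 a =
  w1 * b2 * (w2 ^+ 2) ^+ n * ((1 + a ^+ 2)^-1
    * hgeom n (b2 ^+ 2) ((1 + a ^+ 2)^-1 * (1 + 'i * a * b2 ^+ 2) * - (w1 ^+ 2 + 'i * a))).
Proof.
move=> n0 a0 hb; have a2 := onep_sqr_neq0 a a0; have an0 : a != 0 by rewrite gt_eqF.
have ci : 'i ^+ 2 = -1 :> C := sqrCi C.
rewrite /F10 /Fn fpolyE onep_sqrV //.
set z := (X in hgeom n 1 X); set y := (X in _ = _ * (_ * hgeom n _ X)).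
have -> : y = b2 ^+ 2 * z by rewrite /y /z; field: ci; rewrite ?an0 ?hb ?a2.
rewrite -[X in hgeom n X (_ * z)]mulr1 hgeom_scale exprM2B1 // exprM.
by field: ci; rewrite ?an0 ?a2.
Qed.

Lemma F11E {C : numClosedFieldType} n (w1 w2 b1 b2 a : C) :
  (0 < n)%N -> 0 < a -> w1 != 0 -> b2 != 0 ->
  F11 n w1 w2 b1 b2 a =
  w1 * b2 * (w2 ^+ 2) ^+ n * (b1 ^+ 2) ^+ n * (- ('i * a * (1 + a ^+ 2)^-1)
    * hgeom n (w1 ^+ 2 * b2 ^+ 2)
        ((1 + a ^+ 2)^-1 * - ('i * a + b2 ^+ 2) * - (w1 ^+ 2 + 'i * a))).
Proof.
move=> n0 a0 hw hb; have a2 := onep_sqr_neq0 a a0.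
have ci : 'i ^+ 2 = -1 :> C := sqrCi C.
rewrite /F11 /Fn fpolyE.
set z := (X in hgeom n 1 X); set y := (X in _ = _ * (_ * hgeom n _ X)).
have -> : y = w1 ^+ 2 * b2 ^+ 2 * z by rewrite /y /z; field: ci; rewrite ?hw ?hb ?a2.
rewrite -[X in hgeom n X (_ * z)]mulr1 hgeom_scale [(_ * _) ^+ n.-1]exprMn !exprM2B1 // !exprM.
by ring.
Qed.

(** * Assembling the generating function *)

(** Summing over black vertices first, [x] is the inverse matrix applied to the vector of black
    monomials, and [Gn] pairs it with the white monomials. *)
Lemma Gn_colp {C : numClosedFieldType} n (a w1 w2 b1 b2 : C) :
  (0 < n)%N -> 0 < a ->
  exists2 x : nat -> C,
    forall i : 'I_(n.+1 * n),
      \sum_j Kast n a i j * x j = b2 * (b1 ^+ 2) ^+ (i %/ n) * (b2 ^+ 2) ^+ (i %% n) &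
    Gn n a w1 w2 b1 b2 =
      w1 * \sum_(q < n.+1) (colp n x q).[w1 ^+ 2] * (w2 ^+ 2) ^+ q.
Proof.
move=> n0 a0; have Ku := Kast_unit n a a0.
pose y : 'cV[C]_(n.+1 * n) := \col_i (b1 ^+ bx1 n i * b2 ^+ bx2 n i).
pose x := ext (invmx (Kast n a) *m y)^T; exists x => [i|].
  transitivity (y i 0).
    rewrite -[y](mulKVmx Ku) [RHS]mxE; apply: eq_bigr => j _.
    by rewrite /x ext_val [_^T _ _]mxE.
  by rewrite mxE /bx1 /bx2 !exprM exprD expr1 !exprM; ring.
rewrite /Gn; transitivity (\sum_(j < n.+1 * n) x j * w1 ^+ wx1 n j * w2 ^+ wx2 n j).
  apply: eq_bigr => j _; rewrite /x ext_val [_^T _ _]mxE [(_ *m _) _ _]mxE !mulr_suml.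
  by apply: eq_bigr => i _; rewrite [y _ _]mxE; ring.
rewrite [(n.+1 * n)%N]mulnC (sum_divmod _ _ (fun j => x j * w1 ^+ wx1 n j * w2 ^+ wx2 n j)).
rewrite exchange_big mulr_sumr; apply: eq_bigr => q _.
rewrite horner_poly mulr_suml mulr_sumr; apply: eq_bigr => p _.
rewrite /wx1 /wx2 divnMDl // modnMDl divn_small // modn_small // addn0.
by rewrite exprD !exprM; ring.
Qed.

Theorem theorem2 (C : numClosedFieldType) (n : nat) (a w1 w2 b1 b2 : C) :
  (0 < n)%N -> 0 < a ->
  w1 != 0 -> b2 != 0 -> Cden a w1 w2 != 0 -> Cden a b1 b2 != 0 ->
  Gn n a w1 w2 b1 b2 =
    w1 * w2 ^+ 2 * b2 * fpoly n.+1 (w1 ^+ 2 * b1 ^+ 2) * fpoly n (w2 ^+ 2 * b2 ^+ 2)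
      / Cden a w1 w2
  + (1 + 'i * a * w1 ^+ 2) *
      ((1 + 'i * a * b2 ^+ 2) * F00 n w1 w2 b1 b2 a
       + b1 ^+ 2 * (b2 * w1 * fpoly n (b1 ^+ 2 * w1 ^+ 2)
                    + ('i * a + b2 ^+ 2) * F01 n w1 w2 b1 b2 a))
      / (Cden a w1 w2 * Cden a b1 b2)
  + ('i * a + w1 ^+ 2) * w2 ^+ 2 *
      (b1 ^+ 2 * b2 ^+ (2 * n + 1) * w1 * w2 ^+ (2 * n) * fpoly n (b1 ^+ 2 * w1 ^+ 2)
       + (1 + 'i * a * b2 ^+ 2) * F10 n w1 w2 b1 b2 a
       + b1 ^+ 2 * ('i * a + b2 ^+ 2) * F11 n w1 w2 b1 b2 a)
      / (Cden a w1 w2 * Cden a b1 b2).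
Proof.
move=> n0 a0 hw hb hCw hCb.
have [x hx ->] := Gn_colp n a w1 w2 b1 b2 n0 a0.
have [rec top_eq bottom_eq] := Kast_sides _ _ _ _ _ _ a0 hx.
have gen := linear_rec_gen n ('i * a) (w1 ^+ 2) (w2 ^+ 2) _ _ _
  (fun s => rec s (w1 ^+ 2)).
move: (top_eq (w1 ^+ 2)) (bottom_eq (w1 ^+ 2)) gen.
rewrite /top /bottom -!/(Cden _ _ _).
rewrite F00E F01E // F10E // F11E // !fpolyE [w1 ^+ 2 * b1 ^+ 2]mulrC.
move: (\sum_(q < n.+1) _) (colp n x n).[_] (colp n x 0).[_] => T Xn X0.
(* The sides [Xn] and [X0] come from division by [Cden a b1 b2], then the full sum from division by
   [Cden a w1 w2]. *)
move=> /(canRL (mulKf hCb))-> /(canRL (mulKf hCb))-> /(canRL (mulKf hCw))->.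
rewrite exprD expr1 !exprM.
move: (Cden a w1 w2) (Cden a b1 b2) hCw hCb => Cw Cb hCw hCb.
have a2 := onep_sqr_neq0 a a0.
by rewrite !(exprS _ n); field; rewrite hCw hCb a2.
Qed.
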